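(* Let $\sigma$ be a separable permutation, and suppose that its decomposition tree $\Gamma(\sigma)$ has signature $\lambda$. Then $\sigma$ is equipopular in the class $\mathcal{S}$ of separable permutations to $\omega(\lambda)$; that is, $\nu_\sigma(\mathcal{S}_m)=\nu_{\omega(\lambda)}(\mathcal{S}_m)$ for all $m\ge1$.
   Context: Permutations are nonempty and written in one-line notation. For permutations $\sigma,\tau$ of lengths $n,m$, the direct sum $\sigma\oplus\tau$ is the permutation of length $n+m$ with $(\sigma\oplus\tau)(i)=\sigma(i)$ for $i\le n$ and $\tau(i-n)+n$ for $i>n$; the skew sum $\sigma\ominus\tau$ has $(\sigma\ominus\tau)(i)=\sigma(i)+m$ for $i\le n$ and $\tau(i-n)$ for $i>n$. Both operations are associative. The class $\mathcal{S}$ of separable permutations is the smallest set containing the length-one permutation $1$ and closed under $\oplus$ and $\ominus$; $\mathcal{S}_n$ is the set of those of length $n$. A permutation is sum decomposable if it is a direct sum of two nonempty permutations, and sum indecomposable otherwise; skew (in)decomposable is defined analogously with $\ominus$. An occurrence of a pattern $\sigma$ of length $k$ in $\pi$ is a set of indices $i_1<\dots<i_k$ such that $\pi(i_1),\dots,\pi(i_k)$ has the same relative order as $\sigma(1),\dots,\sigma(k)$. $\nu_\sigma(\pi)$ is the number of occurrences of $\sigma$ in $\pi$, and $\nu_\sigma(\mathcal{X})=\sum_{\pi\in\mathcal{X}}\nu_\sigma(\pi)$. A decomposition tree is a rooted plane tree in which every non-leaf (internal) node is labelled $\oplus$ or $\ominus$ and has at least two children, and the internal children of a node labelled $\oplus$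 are labelled $\ominus$ and vice versa. The bijection $\Gamma$ from $\mathcal{S}$ to decomposition trees is defined recursively: $\Gamma(1)$ is a single node; if $\pi=\sigma_1\oplus\dots\oplus\sigma_k$ with $k\ge2$ and all $\sigma_i$ sum indecomposable, $\Gamma(\pi)$ has a root labelled $\oplus$ whose $k$ child subtrees are $\Gamma(\sigma_1),\dots,\Gamma(\sigma_k)$ in that order; if $\pi$ is skew decomposable, the same with $\ominus$ and skew indecomposable components. The signature of a decomposition tree $T$ with internal nodes $i_1,\dots,i_r$ is the multiset $\{d(i_j)-1\}_{j=1}^r$, where $d(i_j)$ is the number of children of $i_j$. It is regarded as an integer partition $\lambda=\lambda_1,\dots,\lambda_k$ (a partition of $n-1$ if $T$ has $n$ leaves). For a partition $\lambda=\lambda_1,\lambda_2,\dots,\lambda_k$, the permutation $\omega(\lambda)$ is defined recursively by $\omega(\lambda)=I(\lambda_1+1)$ if $k=1$ and $\omega(\lambda)=I(\lambda_1)\oplus\omega(\lambda_2,\dots,\lambda_k)^c$ if $k>1$, where $I(n)=12\cdots n$ is the identity permutation of length $n$ and $\pi^c$ is the complement, $\pi^c(i)=n-\pi(i)+1$ for $\pi$ of length $n$. For the empty partition (the signature of $\Gamma(1)$), $\omega(\lambda)=1$. Equivalently, $\Gamma(\omega(\lambda))$ is the tree with root labelled $\oplus$ having $k$ internal nodes in a chain, each the rightmost child of the previous one, all other nodes being leaves, where the $j$-th internal node has $\lambda_j+1$ children. *)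

(* Defs.v *)
From mathcomp Require Import all_boot.
From mathcomp Require Import boolp zify.
Set Implicit Arguments.
Unset Strict Implicit.
Unset Printing Implicit Defensive.

(* A permutation of length n is represented by its one-line notation, a      *)
(* sequence of naturals rearranging 1, ..., n; permutations are nonempty.    *)
Definition is_perm (s : seq nat) : bool :=
  (s != [::]) && perm_eq s (iota 1 (size s)).

Definition dsum (s t : seq nat) : seq nat := s ++ [seq x + size s | x <- t].

Definition ssum (s t : seq nat) : seq nat := [seq x + size t | x <- s] ++ t.

Definition idperm (n : nat) : seq nat := iota 1 n.

Definition compl (s : seq nat) : seq nat := [seq size s - x + 1 | x <- s].

Inductive separable : seq nat -> Prop :=
| separable_one : separable [:: 1]
| separable_dsum s t : separable s -> separable t -> separable (dsum s t)
| separable_ssum s t : separable s -> separable t -> separable (ssum s t).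

(* The class is given by an inductive proposition, hence the classical       *)
(* truth value `[< _ >]; permutations enumerates without repetition.         *)
Definition Sep (n : nat) : seq (seq nat) :=
  [seq s <- permutations (iota 1 n) | `[< separable s >]].

Definition same_order (s t : seq nat) : bool :=
  (size s == size t) &&
  [forall i : 'I_(size s), forall j : 'I_(size s),
     (nth 0 s i < nth 0 s j) == (nth 0 t i < nth 0 t j)].

(* Positions are numbered from 0; enum A lists the index set A increasingly. *)
Definition occurrences (sigma p : seq nat) : {set {set 'I_(size p)}} :=
  [set A : {set 'I_(size p)} |
     same_order [seq nth 0 p (i : 'I_(size p)) | i <- enum A] sigma].

Definition nu (sigma p : seq nat) : nat := #|occurrences sigma p|.

Definition popularity (sigma : seq nat) (X : seq (seq nat)) : nat :=
  \sum_(p <- X) nu sigma p.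

Inductive label := Plus | Minus.

Definition lsum (l : label) : seq nat -> seq nat -> seq nat :=
  if l is Plus then dsum else ssum.

Definition opp_label (l : label) : label := if l is Plus then Minus else Plus.

Definition decomposable (l : label) (s : seq nat) : Prop :=
  exists t u, [/\ is_perm t, is_perm u & s = lsum l t u].

Inductive tree := Leaf | Node of label & seq tree.

Definition rooted (l : label) (T : tree) : bool :=
  match T, l with
  | Node Plus _, Plus | Node Minus _, Minus => true
  | _, _ => false
  end.

Fixpoint decomposition_tree (T : tree) : bool :=
  if T is Node l Ts then
    [&& 2 <= size Ts, all (fun U => ~~ rooted l U) Ts
      & all decomposition_tree Ts]
  else true.

(* Gamma s T means that T is the tree of s. The empty sequence is neutral    *)
(* for both sums, so the fold below is s_1 + ... + s_k (resp. skew sum).     *)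
(* Gamma_total and Gamma_fun show that this is a function on separable       *)
(* permutations, and Gamma_decomposition_tree that its values are            *)
(* decomposition trees.                                                      *)
Inductive Gamma : seq nat -> tree -> Prop :=
| Gamma_one : Gamma [:: 1] Leaf
| Gamma_node (l : label) (ss : seq (seq nat)) (Ts : seq tree) :
    2 <= size ss ->
    size ss = size Ts ->
    (forall i, i < size ss -> ~ decomposable l (nth [::] ss i)) ->
    (forall i, i < size ss -> Gamma (nth [::] ss i) (nth Leaf Ts i)) ->
    Gamma (foldr (lsum l) [::] ss) (Node l Ts).

Fixpoint reduced_degrees (T : tree) : seq nat :=
  if T is Node _ Ts then
    (size Ts).-1 :: flatten [seq reduced_degrees U | U <- Ts]
  else [::].

(* The multiset of reduced degrees as an integer partition, i.e. with parts  *)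
(* in weakly decreasing order.                                               *)
Definition signature (T : tree) : seq nat := sort geq (reduced_degrees T).

Fixpoint omega (lam : seq nat) : seq nat :=
  match lam with
  | [::] => [:: 1]
  | [:: a] => idperm a.+1
  | a :: lam' => dsum (idperm a) (compl (omega lam'))
  end.

Lemma size_lsum l s t : size (lsum l s t) = size s + size t.
Proof. by case: l; rewrite size_cat size_map. Qed.

Lemma lsums0 l s : lsum l s [::] = s.
Proof.
case: l; rewrite /= /dsum /ssum ?cats0 //=.
by rewrite (eq_map (g := id)) ?map_id // => x; rewrite addn0.
Qed.

Lemma lsum0s l s : lsum l [::] s = s.
Proof.
case: l => //=; rewrite /dsum /=.
by rewrite (eq_map (g := id)) ?map_id // => x; rewrite addn0.
Qed.

Lemma lsumA l s t u : lsum l s (lsum l t u) = lsum l (lsum l s t) u.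
Proof.
case: l; rewrite /= /dsum /ssum ?size_cat ?size_map map_cat -map_comp -!catA.
- congr (_ ++ (_ ++ _)).
  by apply: eq_map => x /=; lia.
- congr (_ ++ _).
  by apply: eq_map => x /=; lia.
Qed.

Lemma lsum_fold_cat l ss ts :
  foldr (lsum l) [::] (ss ++ ts) =
  lsum l (foldr (lsum l) [::] ss) (foldr (lsum l) [::] ts).
Proof.
by elim: ss => [|s ss IH] /=; rewrite ?lsum0s // IH lsumA.
Qed.

Lemma map_addn_iota k n : [seq x + k | x <- iota 1 n] = iota k.+1 n.
Proof.
by rewrite -(addn1 k) iotaDl; apply: eq_map => x; rewrite addnC.
Qed.

Lemma lsum_perm_eq l s t :
  perm_eq s (iota 1 (size s)) -> perm_eq t (iota 1 (size t)) ->
  perm_eq (lsum l s t) (iota 1 (size s + size t)).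
Proof.
case: l => /= ps pt.
- by rewrite iotaD perm_cat // add1n -map_addn_iota perm_map.
- rewrite /ssum perm_catC addnC iotaD perm_cat // add1n -map_addn_iota.
  exact: perm_map.
Qed.

Lemma lsum_is_perm l s t : is_perm s -> is_perm t -> is_perm (lsum l s t).
Proof.
move=> /andP[s0 ps] /andP[_ pt]; rewrite /is_perm -size_eq0 size_lsum.
by rewrite lsum_perm_eq // addn_eq0 size_eq0 (negbTE s0).
Qed.

Lemma separable_is_perm s : separable s -> is_perm s.
Proof.
elim=> // u v _ pu _ pv; first exact: (@lsum_is_perm Plus).
exact: (@lsum_is_perm Minus).
Qed.

Lemma is_perm_bounds s x : is_perm s -> x \in s -> 0 < x <= size s.
Proof. by move=> /andP[_ /perm_mem ->]; rewrite mem_iota add1n ltnS. Qed.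

Lemma decomposable_opp l s : decomposable l s -> ~ decomposable (opp_label l) s.
Proof.
have mr (r : seq nat) x : x \in rcons r x by rewrite mem_rcons mem_head.
have key t u v w : is_perm t -> is_perm u -> is_perm v -> is_perm w ->
    dsum t u = ssum v w -> False.
  case: t => // x t; case/lastP: u => // u y; case: v => // z v.
  case/lastP: w => // w e pt pu pv pw E.
  have Ex : x = z + size (rcons w e) by case: E.
  have Ey : y + size (x :: t) = e.
    have := congr1 (last 0) E.
    by rewrite /dsum /ssum map_rcons !last_cat !last_rcons.
  have := is_perm_bounds pt (mem_head _ _).
  have := is_perm_bounds pu (mr u y).
  have := is_perm_bounds pv (mem_head _ _).
  have := is_perm_bounds pw (mr w e).
  by rewrite /= !size_rcons in Ex Ey *; lia.
case: l => /= -[t [u [pt pu /= E]]] [v [w [pv pw /= E']]].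
  by apply: (key t u v w) => //; rewrite -E.
by apply: (key v w t u) => //; rewrite -E.
Qed.

Lemma one_indecomposable l : ~ decomposable l [:: 1].
Proof.
case=> t [u [/andP[t0 _] /andP[u0 _]]] /(congr1 size); rewrite size_lsum /=.
by case: t u t0 u0 => [|x t] [|y u] //= _ _; lia.
Qed.

Lemma fold_is_perm l ss : 0 < size ss ->
  (forall i, i < size ss -> is_perm (nth [::] ss i)) ->
  is_perm (foldr (lsum l) [::] ss).
Proof.
elim: ss => [|s [|t ss] IH] // _ H; first by rewrite /= lsums0; apply: (H 0).
by apply: lsum_is_perm; [apply: (H 0)|apply: IH => // i; apply: (H i.+1)].
Qed.

Lemma fold_decomposable l ss : 1 < size ss ->
  (forall i, i < size ss -> is_perm (nth [::] ss i)) ->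
  decomposable l (foldr (lsum l) [::] ss).
Proof.
case: ss => [|s ss] //= n1 H; exists s, (foldr (lsum l) [::] ss).
by split=> //; [apply: (H 0)|apply: fold_is_perm => // i; apply: (H i.+1)].
Qed.

Lemma Gamma_is_perm s T : Gamma s T -> is_perm s.
Proof.
elim=> // l ss Ts n1 _ _ _ IH; apply: fold_is_perm => //; exact: ltnW.
Qed.

Lemma Gamma_rooted l s T : Gamma s T -> ~ decomposable l s -> ~~ rooted l T.
Proof.
case=> [|l' ss Ts n1 _ _ H] D; first by case: l D.
have D' : ~ decomposable l' (foldr (lsum l') [::] ss) -> False.
  by case; apply: fold_decomposable => // i /H /Gamma_is_perm.
by case: l l' D D' {H} => -[] D D' //=; case: (D' D).
Qed.

Lemma Gamma_decomposition_tree s T : Gamma s T -> decomposition_tree T.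
Proof.
elim=> // l ss Ts n1 En ND HG IH; rewrite /= -En n1 /=.
apply/andP; split; apply/(all_nthP Leaf) => i; rewrite -En => Hi.
  exact: Gamma_rooted (HG i Hi) (ND i Hi).
exact: IH.
Qed.

Lemma Gamma_indecomposable l s T : Gamma s T -> ~~ rooted l T ->
  ~ decomposable l s.
Proof.
case=> [_|l' ss Ts n1 _ _ H nr]; first exact: one_indecomposable.
have -> : l = opp_label l' by case: l l' nr {H} => -[].
by apply: decomposable_opp; apply: fold_decomposable => // i /H /Gamma_is_perm.
Qed.

Lemma Gamma_components l s T : Gamma s T ->
  exists ss Ts, [/\ 0 < size ss, size ss = size Ts,
    s = foldr (lsum l) [::] ss,
    forall i, i < size ss -> ~ decomposable l (nth [::] ss i) &
    forall i, i < size ss -> Gamma (nth [::] ss i) (nth Leaf Ts i)].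
Proof.
move=> G; have [r|nr] := boolP (rooted l T); last first.
  exists [:: s], [:: T]; split=> //=; first by rewrite lsums0.
    by case=> // _; apply: Gamma_indecomposable G nr.
  by case.
case: G r => [|l' ss Ts n1 En ND HG]; first by case: l.
move=> r; have E : l = l' by case: l l' r {ND} => -[].
by exists ss, Ts; rewrite E; split=> //; apply: ltnW.
Qed.

Lemma Gamma_lsum l s t T U : Gamma s T -> Gamma t U ->
  exists V, Gamma (lsum l s t) V.
Proof.
move=> /(Gamma_components l)[ss [Ts [n1 E1 -> D1 G1]]].
move=> /(Gamma_components l)[ts [Us [n2 E2 -> D2 G2]]].
exists (Node l (Ts ++ Us)); rewrite -lsum_fold_cat.
apply: Gamma_node; rewrite ?size_cat ?E1 ?E2 //.
- by rewrite -E1 -E2; lia.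
- move=> i; rewrite -E1 -E2 nth_cat => Hi.
  by case: ltnP => Hi'; [apply: D1|apply: D2; lia].
- move=> i; rewrite -E1 -E2 !nth_cat -E1 => Hi.
  by case: ltnP => Hi'; [apply: G1|apply: G2; lia].
Qed.

Lemma Gamma_total s : separable s -> exists T, Gamma s T.
Proof.
elim=> [|t u _ [T GT] _ [U GU]|t u _ [T GT] _ [U GU]].
- by exists Leaf; apply: Gamma_one.
- exact: (@Gamma_lsum Plus _ _ _ _ GT GU).
- exact: (@Gamma_lsum Minus _ _ _ _ GT GU).
Qed.

Lemma cat_shift_perm s t e : is_perm s -> is_perm t -> size t < size s ->
  perm_eq s (t ++ e) -> exists2 r, is_perm r & e = [seq x + size t | x <- r].
Proof.
move=> /andP[_ ps] /andP[_ pt] lt pe.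
have se : size s = size t + size e by rewrite (perm_size pe) size_cat.
have : perm_eq (iota 1 (size t) ++ e)
               (iota 1 (size t) ++ [seq x + size t | x <- iota 1 (size e)]).
  rewrite map_addn_iota -add1n -iotaD -se.
  apply: perm_trans ps; rewrite perm_sym (perm_trans pe) //.
  by rewrite perm_cat2r.
rewrite perm_cat2l => pe'.
have Ee : e = [seq x + size t | x <- [seq x - size t | x <- e]].
  rewrite -map_comp -[LHS]map_id; apply/eq_in_map => x /=.
  by rewrite (perm_mem pe') => /mapP[y _ ->]; lia.
exists [seq x - size t | x <- e] => //.
apply/andP; split; first by rewrite -size_eq0 size_map; lia.
by rewrite size_map; apply: (perm_map_inj (@addIn (size t))); rewrite -Ee.
Qed.

Lemma lsum_cancel l s t u v : is_perm s -> is_perm t ->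
  perm_eq u (iota 1 (size u)) -> perm_eq v (iota 1 (size v)) ->
  lsum l s u = lsum l t v -> size t < size s -> decomposable l s.
Proof.
move=> ps pt pu pv E lt.
have sz : size s + size u = size t + size v by rewrite -!(size_lsum l) E.
case: l E => /= E.
- have Es : s = t ++ take (size s - size t) [seq x + size t | x <- v].
    have := congr1 (take (size s)) E.
    by rewrite take_size_cat // take_cat ltnNge (ltnW lt).
  have pe : perm_eq s s by [].
  rewrite {2}Es in pe; have [r pr Er] := cat_shift_perm ps pt lt pe.
  by exists t, r; rewrite pt pr /= /dsum -Er.
- set e := drop (size t) [seq x + size u | x <- s].
  have Ev : v = e ++ u.
    have := congr1 (drop (size t)) E.
    by rewrite /ssum drop_cat size_map lt drop_size_cat ?size_map.
  have Et : [seq x + size v | x <- t] = take (size t) [seq x + size u | x <- s].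
    have := congr1 (take (size t)) E.
    by rewrite /ssum take_cat size_map lt take_size_cat ?size_map.
  pose r := drop (size t) s.
  have se : size v = size r + size u by rewrite size_drop; lia.
  have Es : s = ssum t r.
    apply: (inj_map (@addIn (size u))).
    rewrite -[in LHS](cat_take_drop (size t) s) /ssum !map_cat map_take -Et.
    congr (_ ++ _); rewrite -map_comp.
    by apply: eq_map => x /=; rewrite se addnA.
  exists t, r; split=> //; apply/andP; split.
    by rewrite -size_eq0 size_drop subn_eq0 -ltnNge.
  move/andP: ps => [_]; rewrite {1}Es /ssum.
  rewrite (_ : size s = size r + size t); last by rewrite Es size_cat size_map addnC.
  rewrite iotaD => H.
  have /andP[_ pt'] := pt.
  have : perm_eq ([seq x + size r | x <- t] ++ r)
                 ([seq x + size r | x <- t] ++ iota 1 (size r)).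
    apply: (perm_trans H); rewrite perm_catC perm_cat2r add1n -map_addn_iota.
    by rewrite perm_sym perm_map.
  by rewrite perm_cat2l.
Qed.

Lemma lsum_inj l s t u v : size s = size t ->
  lsum l s u = lsum l t v -> s = t /\ u = v.
Proof.
move=> est E; have euv : size u = size v.
  by have := congr1 size E; rewrite !size_lsum est => /addnI.
case: l E => /= /eqP; rewrite /dsum /ssum eqseq_cat ?size_map ?est ?euv //.
- by case/andP=> /eqP -> /eqP /inj_map ->; last exact: addIn.
- by case/andP=> /eqP Hs /eqP ->; split=> //; apply: inj_map Hs; exact: addIn.
Qed.

Lemma fold_perm_eq l ss : (forall i, i < size ss -> is_perm (nth [::] ss i)) ->
  perm_eq (foldr (lsum l) [::] ss) (iota 1 (size (foldr (lsum l) [::] ss))).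
Proof.
case: ss => // s ss H.
by have /andP[] := @fold_is_perm l (s :: ss) isT H.
Qed.

Lemma components_uniq l ss ts :
  (forall i, i < size ss -> is_perm (nth [::] ss i)) ->
  (forall i, i < size ts -> is_perm (nth [::] ts i)) ->
  (forall i, i < size ss -> ~ decomposable l (nth [::] ss i)) ->
  (forall i, i < size ts -> ~ decomposable l (nth [::] ts i)) ->
  foldr (lsum l) [::] ss = foldr (lsum l) [::] ts -> ss = ts.
Proof.
have nz s ss' : is_perm s -> [::] = lsum l s ss' -> False.
  move=> /andP[s0 _] /(congr1 size); rewrite size_lsum /=.
  by case: s s0.
elim: ss ts => [|s ss IH] [|t ts] // ps pt ds dt /= E.
- by case: (nz _ _ (pt 0 isT) E).
- by case: (nz _ _ (ps 0 isT) (esym E)).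
have pss := @fold_perm_eq l ss (fun i => ps i.+1).
have pts := @fold_perm_eq l ts (fun i => pt i.+1).
have [lt|lt|eq] := ltngtP (size s) (size t).
- by case: (dt 0 isT); apply: lsum_cancel (pt 0 isT) (ps 0 isT) pts pss (esym E) lt.
- by case: (ds 0 isT); apply: lsum_cancel (ps 0 isT) (pt 0 isT) pss pts E lt.
have [-> E'] := lsum_inj eq E; congr cons.
apply: IH E' => i; [exact: (ps i.+1)|exact: (pt i.+1)|exact: (ds i.+1)|].
exact: (dt i.+1).
Qed.

Lemma Gamma_fun s T U : Gamma s T -> Gamma s U -> T = U.
Proof.
move=> G; elim: G U => [|l ss Ts n1 En ND HG IH] U.
  move Es: [:: 1] => s' GU; case: GU Es => // l ss Ts n1 _ _ HG Es.
  case: (@one_indecomposable l); rewrite Es.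
  by apply: fold_decomposable => // i /HG /Gamma_is_perm.
have Dl : decomposable l (foldr (lsum l) [::] ss).
  by apply: fold_decomposable => // i /HG /Gamma_is_perm.
move Es: (foldr _ _ _) Dl => s' Dl GU.
case: GU Es Dl => [_ /one_indecomposable //|l' ss' Us n1' En' ND' HG' Es Dl].
have Dl' : decomposable l' (foldr (lsum l') [::] ss').
  by apply: fold_decomposable => // i /HG' /Gamma_is_perm.
have El : l' = l by case: l l' Dl Dl' {ND ND' Es} => -[] // /decomposable_opp.
rewrite {}El in ND' Es *; have Ess : ss = ss'.
  by apply: components_uniq Es => // i;
    [move/HG; apply: Gamma_is_perm|move/HG'; apply: Gamma_is_perm].
congr Node; apply: (@eq_from_nth _ Leaf); first by rewrite -En -En' Ess.
by move=> i; rewrite -En => Hi; apply: IH => //; rewrite Ess; apply: HG'; rewrite -Ess.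
Qed.

(* Main.v *)
Require Import Defs.
From mathcomp Require Import all_boot all_algebra.
From mathcomp Require Import boolp zify ring.
Set Implicit Arguments.
Unset Strict Implicit.
Unset Printing Implicit Defensive.
Import GRing.Theory.

(* An occurrence of s = s_1 + ... + s_k (components indecomposable for the   *)
(* sum +) in p + q puts s_1 + ... + s_j in p and the rest in q, for a unique *)
(* j. Splitting off the first component of every separable permutation gives *)
(* for the generating function G_s of the popularity of s in S, and for its  *)
(* analogue H_s over the indecomposable separable permutations, the equation *)
(*   G_s = sum_{j <= k} H_{s_1 + ... + s_j} G_{s_{j+1} + ... + s_k},         *)
(* where the terms j = 0 and j = k involve H_empty = A and G_empty = 1/D,    *)
(* D = 1 - A. For k = 1 this reads H_s = D^2 G_s. A separable permutation    *)
(* other than 1 is decomposable for exactly one of the two sums, so that     *)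
(* H_s = (1 - D^2) G_s for k > 1, and the equation becomes                   *)
(*   (2 D^2 - 1) G_s =                                                       *)
(*     D sum_{0 < j < k} h_j G_{s_1 + ... + s_j} G_{s_{j+1} + ... + s_k},    *)
(* with h_1 = D^2 and h_j = 1 - D^2 for j > 1. Hence G_s is                  *)
(* c_k G_{s_1} ... G_{s_k} with c_k depending only on k, and G_s is the      *)
(* product of c_{d(i)} over the internal nodes i of the tree of s times a    *)
(* power of G_1, which only depends on the signature. Power series are       *)
(* replaced by their values at an element x of a ring in which x ^+ N = 0.   *)

(** The identity comes from a factorization over trees: the series of a sum of k indecomposables is
    a constant depending only on k times the product of the series of its components, whichever of
    the two sums is used. Down a tree this leaves one constant per internal node and one series of
    the pattern 1 per leaf, so the shape and the labels are forgotten and only the multiset of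
    degrees remains. The combinatorics is in [nu_lsum] (an occurrence is cut between two components)
    and [big_Sep] (unique first component). [gf_fold_rec] turns them into a recurrence, [gf_fold]
    solves it, and [gf_Gamma] climbs the tree. [omega_alternating] and [Gamma_alternating] supply a
    tree for [omega]; [popularity_gf_inj] recovers the popularities. *)

(** * Occurrences as subsequences *)

(* One entry for each set of positions of p, hence repetitions.              *)
Fixpoint subseqs (p : seq nat) : seq (seq nat) :=
  if p is x :: q then [seq x :: u | u <- subseqs q] ++ subseqs q
  else [:: [::]].

Fixpoint bitseqs (n : nat) : seq bitseq :=
  if n is k.+1 then
    [seq true :: m | m <- bitseqs k] ++ [seq false :: m | m <- bitseqs k]
  else [:: [::]].

Lemma mem_bitseqs n m : (m \in bitseqs n) = (size m == n).
Proof.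
elim: n m => [|n IH] [|b m] //=; rewrite mem_cat.
  by apply/negbTE; rewrite negb_or; apply/andP; split; apply/mapP => -[].
have mapb c : (b :: m \in [seq c :: m0 | m0 <- bitseqs n]) = (b == c) && (size m == n).
  apply/mapP/andP => [[m' Hm' [-> ->]]|[/eqP -> Hm]].
    by rewrite eqxx -IH.
  by exists m => //; rewrite IH.
by rewrite !mapb eqSS -andb_orl; case: (b).
Qed.

Lemma bitseqs_uniq n : uniq (bitseqs n).
Proof.
elim: n => //= n IH; rewrite cat_uniq !map_inj_uniq ?IH /=; try by move=> ? ? [].
by rewrite andbT; apply/hasPn => m /mapP[u _ ->]; apply/mapP => -[].
Qed.

Lemma big_bitseqs_subseqs (p : seq nat) (F : seq nat -> nat) :
  \sum_(m <- bitseqs (size p)) F (mask m p) = \sum_(u <- subseqs p) F u.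
Proof.
elim: p F => [|x p IH] F; first by rewrite !big_seq1.
rewrite /= !big_cat !big_map /= -(IH F) -(IH (fun u => F (x :: u))) //.
Qed.

(** Sets of positions correspond to boolean tuples, and such a tuple used as a mask on [p] selects
    the entries at those positions in increasing order. *)
Lemma nu_subseqs s p : nu s p = \sum_(u <- subseqs p) same_order u s.
Proof.
rewrite -(big_bitseqs_subseqs p (fun u => same_order u s)) /nu.
rewrite -sum1_card big_mkcond /=.
pose f (m : (size p).-tuple bool) : {set 'I_(size p)} := [set i | tnth m i].
pose g (A : {set 'I_(size p)}) := [tuple i \in A | i < size p].
have fK : cancel f g.
  by move=> m; apply: eq_from_tnth => i; rewrite tnth_mktuple inE.
have gK : cancel g f.
  by move=> A; apply/setP => i; rewrite inE tnth_mktuple.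
rewrite (reindex f) /=; last by exists g => ? _.
have -> : \sum_(m <- bitseqs (size p)) same_order (mask m p) s =
  \sum_(m <- [seq tval m | m : (size p).-tuple bool]) same_order (mask m p) s.
  apply: perm_big; apply: uniq_perm; first exact: bitseqs_uniq.
    by rewrite map_inj_uniq ?enum_uniq //; apply: val_inj.
  move=> m; rewrite mem_bitseqs; apply/idP/mapP => [Hm|[t _ ->]].
    by exists (Tuple Hm) => //; rewrite mem_enum.
  by rewrite size_tuple.
rewrite big_map big_enum /=; apply: eq_bigr => m _.
rewrite inE.
suff -> : [seq nth 0 p (i : 'I_(size p)) | i <- enum (f m)] = mask m p.
  by case: same_order.
have Ep : [seq nth 0 p (i : 'I_(size p)) | i <- enum 'I_(size p)] = p.
  by rewrite -[RHS](mkseq_nth 0) /mkseq -val_enum_ord -map_comp.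
transitivity (mask m [seq nth 0 p (i : 'I_(size p)) | i <- enum 'I_(size p)]);
  last by rewrite Ep.
rewrite -map_mask; congr map.
have -> : tval m = [seq i \in f m | i <- enum 'I_(size p)].
  by rewrite -[in LHS](fK m).
by rewrite -filter_mask enumT /enum_mem; apply: eq_filter.
Qed.

Lemma big_subseqs_cat (s t : seq nat) (F : seq nat -> nat) :
  \sum_(u <- subseqs (s ++ t)) F u =
  \sum_(a <- subseqs s) \sum_(b <- subseqs t) F (a ++ b).
Proof.
elim: s F => [|x s IH] F /=; first by rewrite big_seq1.
by rewrite !big_cat !big_map /= (IH F) (IH (fun u => F (x :: u))).
Qed.

Lemma subseqs_map f p : subseqs (map f p) = [seq map f u | u <- subseqs p].
Proof.
elim: p => //= x p IH; rewrite IH map_cat -!map_comp.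
by congr (_ ++ _); apply: eq_map.
Qed.

Lemma subseqs_subset p u : u \in subseqs p -> {subset u <= p}.
Proof.
elim: p u => [|x p IH] u /=; first by rewrite inE => /eqP ->.
rewrite mem_cat => /orP[/mapP[v /IH vp ->]|/IH up] y.
  by rewrite !inE => /orP[->|/vp ->]; rewrite ?orbT.
by rewrite inE => /up ->; rewrite orbT.
Qed.

Lemma same_orderP s t :
  reflect (size s = size t /\ forall i j, i < size s -> j < size s ->
             (nth 0 s i < nth 0 s j) = (nth 0 t i < nth 0 t j))
          (same_order s t).
Proof.
apply: (iffP andP) => -[].
  move=> /eqP E /forallP H; split=> // i j Hi Hj.
  by have /forallP /(_ (Ordinal Hj)) /eqP := H (Ordinal Hi).
move=> E H; split; first exact/eqP.
by apply/forallP => i; apply/forallP => j; apply/eqP; apply: H.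
Qed.

Lemma same_order_shift c s t : same_order [seq x + c | x <- s] t = same_order s t.
Proof.
apply/same_orderP/same_orderP; rewrite size_map => -[E H]; split=> // i j Hi Hj.
  by rewrite -H // !(nth_map 0) // ltn_add2r.
by rewrite !(nth_map 0) // ltn_add2r H.
Qed.

(** * Patterns in sums *)

(** The order between an entry of the first summand and one of the second, so that both sums are
    treated at once. *)
Definition precedes (l : label) (x y : nat) : bool :=
  if l is Plus then x < y else y < x.

(** Sorting the two blocks separately already sorts the whole word, so the sorted blocks are
    consecutive intervals. *)
Lemma perm_eq_iota_cat (s t : seq nat) n :
  perm_eq (s ++ t) (iota 1 n) -> allrel ltn s t ->
  perm_eq s (iota 1 (size s)) /\ perm_eq t (iota (size s).+1 (size t)).
Proof.
move=> p st; have E : sort leq s ++ sort leq t = iota 1 n.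
  apply: (sorted_eq leq_trans anti_leq); last first.
  - by apply: perm_trans p; rewrite perm_cat // perm_sort.
  - exact: iota_sorted.
  rewrite (sorted_pairwise leq_trans) pairwise_cat.
  rewrite -!(sorted_pairwise leq_trans) !sort_sorted; try exact: leq_total.
  rewrite !andbT; apply/allrelP => x y; rewrite !mem_sort => xs yt.
  by apply: ltnW; apply: (allrelP st).
have En : n = size s + size t by rewrite -(size_iota 1 n) -(perm_size p) size_cat.
move: E; rewrite En iotaD add1n => /eqP; rewrite eqseq_cat ?size_sort ?size_iota //.
by case/andP=> /eqP Es /eqP Et; rewrite -{1}Es -Et !(perm_sym _ (sort _ _)) !perm_sort.
Qed.

Lemma unshift (s : seq nat) k n : perm_eq s (iota k.+1 n) ->
  exists2 r, perm_eq r (iota 1 n) & s = [seq x + k | x <- r].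
Proof.
move=> p; have E : s = [seq x + k | x <- [seq x - k | x <- s]].
  rewrite -map_comp -[LHS]map_id; apply/eq_in_map => x /=.
  by rewrite (perm_mem p) mem_iota; lia.
exists [seq x - k | x <- s] => //.
by apply: (perm_map_inj (@addIn k)); rewrite -E map_addn_iota.
Qed.

Lemma split_lsum l (s t : seq nat) :
  perm_eq (s ++ t) (iota 1 (size (s ++ t))) -> allrel (precedes l) s t ->
  exists s' t', [/\ perm_eq s' (iota 1 (size s')), perm_eq t' (iota 1 (size t')),
    size s' = size s & s ++ t = lsum l s' t'].
Proof.
have sz (u v : seq nat) k : perm_eq u (iota 1 (size v)) ->
    v = [seq x + k | x <- u] -> perm_eq u (iota 1 (size u)).
  by move=> + Ev; rewrite Ev size_map.
case: l => /= p st.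
  have [ps /unshift[r pr Et]] := perm_eq_iota_cat p st.
  exists s, r; split=> //; first exact: sz pr Et.
  by rewrite /dsum -Et.
have ts : allrel ltn t s by rewrite allrelC.
rewrite perm_catC size_cat addnC -size_cat in p.
have [pt /unshift[r pr Es]] := perm_eq_iota_cat p ts.
exists r, t; split=> //; first exact: sz pr Es.
  by rewrite Es size_map.
by rewrite /ssum -Es.
Qed.

Lemma perm_eq_iota_mem (s : seq nat) x : perm_eq s (iota 1 (size s)) ->
  x \in s -> 0 < x <= size s.
Proof. by move=> /perm_mem ->; rewrite mem_iota add1n ltnS. Qed.

Definition is_plus (l : label) : bool := if l is Plus then true else false.

Lemma precedes_ltn l x y : precedes l x y ->
  (x < y) = is_plus l /\ (y < x) = ~~ is_plus l.
Proof. by case: l => /= H; lia. Qed.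

(** The existential form hides which summand is shifted: pattern containment does not see shifts. *)
Lemma precedes_lsum l (s t : seq nat) : perm_eq s (iota 1 (size s)) ->
  perm_eq t (iota 1 (size t)) ->
  exists s' t', [/\ lsum l s t = s' ++ t', allrel (precedes l) s' t',
    (exists c, s' = [seq x + c | x <- s]) & exists c, t' = [seq x + c | x <- t]].
Proof.
have m0 (u : seq nat) : u = [seq x + 0 | x <- u].
  by rewrite (eq_map (g := id)) ?map_id // => x; rewrite addn0.
move=> ps pt; case: l => /=.
  exists s, [seq x + size s | x <- t]; split=> //; [|by exists 0|by eexists].
  apply/allrelP => x _ xs /mapP[y yt ->] /=.
  by have := perm_eq_iota_mem ps xs; have := perm_eq_iota_mem pt yt; lia.
exists [seq x + size t | x <- s], t; split=> //; [|by eexists|by exists 0].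
apply/allrelP => _ y /mapP[x xs ->] yt /=.
by have := perm_eq_iota_mem ps xs; have := perm_eq_iota_mem pt yt; lia.
Qed.

(** Comparisons across the cut are dictated by [l] on both sides, so only those inside the blocks
    matter. *)
Lemma same_order_cat l a b s t : allrel (precedes l) a b ->
  allrel (precedes l) s t -> size a = size s ->
  same_order (a ++ b) (s ++ t) = same_order a s && same_order b t.
Proof.
move=> ab st Es; apply/same_orderP/andP.
  rewrite !size_cat Es => -[/addnI Et H]; split; apply/same_orderP; split=> // i j.
    by rewrite Es => Hi Hj; have := H i j; rewrite !nth_cat Es Hi Hj; apply; lia.
  move=> Hi Hj; have := H (size s + i) (size s + j); rewrite !nth_cat Es.
  rewrite !ltnNge !leq_addr /= !addKn; apply; lia.
move=> [/same_orderP[_ Hs] /same_orderP[Et Ht]]; split; first by rewrite !size_cat Es Et.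
move=> i j; rewrite size_cat !nth_cat -!Es => Hi Hj.
have [Hi'|Hi'] := ltnP i (size a); have [Hj'|Hj'] := ltnP j (size a).
- exact: Hs.
- have Hb : j - size a < size b by lia.
  have Hs' : i < size s by rewrite -Es.
  have Ht' : j - size a < size t by rewrite -Et.
  rewrite (precedes_ltn (allrelP ab _ _ (mem_nth 0 Hi') (mem_nth 0 Hb))).1.
  by rewrite (precedes_ltn (allrelP st _ _ (mem_nth 0 Hs') (mem_nth 0 Ht'))).1.
- have Hb : i - size a < size b by lia.
  have Hs' : j < size s by rewrite -Es.
  have Ht' : i - size a < size t by rewrite -Et.
  rewrite (precedes_ltn (allrelP ab _ _ (mem_nth 0 Hj') (mem_nth 0 Hb))).2.
  by rewrite (precedes_ltn (allrelP st _ _ (mem_nth 0 Hs') (mem_nth 0 Ht'))).2.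
- by apply: Ht; lia.
Qed.

Lemma same_order_precedes l a b s : allrel (precedes l) a b ->
  same_order (a ++ b) s ->
  allrel (precedes l) (take (size a) s) (drop (size a) s).
Proof.
move=> ab /same_orderP[]; rewrite size_cat => Es H.
apply/allrelP => x y /(nthP 0)[i Hi <-] /(nthP 0)[j Hj <-].
rewrite size_take_min size_drop in Hi Hj.
rewrite nth_take ?nth_drop; last lia.
have Hi' : i < size a by lia.
have Hj' : j < size b by rewrite -Es addKn in Hj.
have := H i (size a + j); have := H (size a + j) i; rewrite !nth_cat Hi'.
have -> : (size a + j < size a) = false by lia.
rewrite addKn.
have := allrelP ab _ _ (mem_nth 0 Hi') (mem_nth 0 Hj').
by case: l {ab} => /= -> E1 E2; [rewrite -E2|rewrite -E1]; lia.
Qed.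

(** * Cutting a pattern between its components *)

Lemma same_orderC s t : same_order s t = same_order t s.
Proof.
by apply/same_orderP/same_orderP => -[E H]; split=> // i j Hi Hj;
  rewrite H // E.
Qed.

(** Admits the empty word, which arises when a cut puts the whole pattern on one side. *)
Definition perm0 (s : seq nat) : bool := perm_eq s (iota 1 (size s)).

Definition components (l : label) (ss : seq (seq nat)) : Prop :=
  forall s, s \in ss -> is_perm s /\ ~ decomposable l s.

Lemma components_cat l ss ts :
  components l (ss ++ ts) <-> components l ss /\ components l ts.
Proof.
split=> [H|[Hs Ht] s]; last by rewrite mem_cat => /orP[/Hs|/Ht].
by split=> s Hs; apply: H; rewrite mem_cat Hs ?orbT.
Qed.

Lemma components_take l ss j : components l ss -> components l (take j ss).
Proof. by rewrite -{1}(cat_take_drop j ss) => /components_cat[]. Qed.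

Lemma components_drop l ss j : components l ss -> components l (drop j ss).
Proof. by rewrite -{1}(cat_take_drop j ss) => /components_cat[]. Qed.

Lemma components_nth l ss : components l ss -> forall i, i < size ss ->
  is_perm (nth [::] ss i) /\ ~ decomposable l (nth [::] ss i).
Proof. by move=> H i Hi; apply: H; apply: mem_nth. Qed.

Lemma is_permE s : is_perm s = (0 < size s) && perm0 s.
Proof. by rewrite /is_perm lt0n size_eq0. Qed.

Lemma fold_perm0 l ss : components l ss -> perm0 (foldr (lsum l) [::] ss).
Proof. by move=> H; apply: fold_perm_eq => i /(components_nth H)[]. Qed.

Lemma fold_size_ge l ss : components l ss ->
  size ss <= size (foldr (lsum l) [::] ss).
Proof.
elim: ss => //= s ss IH H; rewrite size_lsum.
have [] := H s (mem_head _ _); rewrite is_permE => /andP[s0 _] _.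
have : components l ss by move=> t Ht; apply: H; rewrite inE Ht orbT.
by move/IH; lia.
Qed.

Lemma components_exist l s : perm0 s ->
  exists2 ss, components l ss & s = foldr (lsum l) [::] ss.
Proof.
have [n] := ubnP (size s); elim: n s => // n IH s ltn ps.
have [->|s0] := eqVneq s [::]; first by exists [::].
have ps' : is_perm s by rewrite /is_perm s0.
have [[t [u [pt pu E]]]|D] := EM (decomposable l s); last first.
  exists [:: s]; rewrite /= ?lsums0 //.
  by move=> t; rewrite inE => /eqP ->.
move: pt pu; rewrite !is_permE => /andP[t0 pt] /andP[u0 pu].
move: ltn; rewrite E size_lsum => ltn.
have [||ts Cts Et] := IH t; rewrite ?pt //; first lia.
have [||us Cus Eu] := IH u; rewrite ?pu //; first lia.
exists (ts ++ us); first exact/components_cat.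
by rewrite lsum_fold_cat -Et -Eu.
Qed.

Lemma size_fold_take_inj l ss i j : components l ss ->
  i <= size ss -> j <= size ss ->
  size (foldr (lsum l) [::] (take i ss)) = size (foldr (lsum l) [::] (take j ss)) ->
  i = j.
Proof.
move=> C; wlog ij : i j / i <= j => [H Hi Hj E|Hi Hj].
  by have [/H->|/ltnW/H->] := leqP i j.
rewrite -(cat_take_drop i (take j ss)) take_takel // lsum_fold_cat size_lsum.
have := fold_size_ge (@components_drop _ _ i (@components_take _ _ j C)).
by rewrite size_drop size_take_min; lia.
Qed.

Lemma same_order_lsum l a b s t : allrel (precedes l) a b ->
  perm0 s -> perm0 t -> size a = size s ->
  same_order (a ++ b) (lsum l s t) = same_order a s && same_order b t.
Proof.
move=> ab ps pt Es.
have [s' [t' [-> st [c Ec] [d Ed]]]] := precedes_lsum l ps pt.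
rewrite (same_order_cat ab st) ?Ec ?Ed ?size_map //.
rewrite !(same_orderC _ (map _ _)) !same_order_shift.
by rewrite !(same_orderC _ a) !(same_orderC _ b).
Qed.

(** At most one [j] contributes, the one whose first [j] components have total length [size a]. If
    the pattern matches, cutting it after [size a] entries writes it as an [l]-sum; by uniqueness of
    components this cut falls between two of them, so such a [j] exists. *)
Lemma same_order_components l a b ss : allrel (precedes l) a b ->
  components l ss ->
  same_order (a ++ b) (foldr (lsum l) [::] ss) =
  \sum_(j < (size ss).+1) same_order a (foldr (lsum l) [::] (take j ss)) *
                          same_order b (foldr (lsum l) [::] (drop j ss)) :> nat.
Proof.
move=> ab C; set so := same_order (a ++ b) _.
pose fits (j : 'I_(size ss).+1) :=
  size a == size (foldr (lsum l) [::] (take j ss)).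
have term (j : 'I_(size ss).+1) :
    same_order a (foldr (lsum l) [::] (take j ss)) *
    same_order b (foldr (lsum l) [::] (drop j ss)) = so && fits j.
  have [E|E] := boolP (fits j); last first.
    by rewrite andbF /same_order; move: E; rewrite /fits => /negbTE ->.
  rewrite /so -[in RHS](cat_take_drop j ss) lsum_fold_cat.
  rewrite same_order_lsum ?fold_perm0 ?(eqP E) ?andbT ?mulnb //.
    exact: components_take.
  exact: components_drop.
rewrite (eq_bigr _ (fun j _ => term j)).
have [Hso|] := boolP so; last by rewrite big1.
have [s' [t' [ps pt Es E]]] : exists s' t', [/\ perm0 s', perm0 t',
    size s' = size a & foldr (lsum l) [::] ss = lsum l s' t'].
  have := same_order_precedes ab Hso.
  move/split_lsum; rewrite cat_take_drop => /(_ (fold_perm0 C)).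
  case=> s' [t' [ps pt Es E]]; exists s', t'; split=> //.
  rewrite Es size_take_min; apply/minn_idPl.
  by move/same_orderP: Hso => -[<- _]; rewrite size_cat leq_addr.
have [us Cus Eu] := components_exist l ps.
have [vs Cvs Ev] := components_exist l pt.
have Ess : ss = us ++ vs.
  have Cuv : components l (us ++ vs) by apply/components_cat.
  apply: (@components_uniq l) => [i Hi|i Hi|i Hi|i Hi|].
  - by case: (components_nth C Hi).
  - by case: (components_nth Cuv Hi).
  - by case: (components_nth C Hi).
  - by case: (components_nth Cuv Hi).
  - by rewrite lsum_fold_cat -Eu -Ev.
have Hj : size us < (size ss).+1 by rewrite Ess size_cat; lia.
have fj : fits (Ordinal Hj) by rewrite /fits /= Ess take_size_cat // -Eu Es.
rewrite (bigD1 (Ordinal Hj)) //= fj big1 // => j nj; apply/eqP.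
rewrite eqb0; apply: contra nj => fj'; apply/eqP/val_inj => /=.
apply: (size_fold_take_inj C); rewrite -1?ltnS ?ltn_ord //.
by rewrite -(eqP fj) -(eqP fj').
Qed.

Lemma nu_shift s c p : nu s [seq x + c | x <- p] = nu s p.
Proof.
rewrite !nu_subseqs subseqs_map big_map.
by apply: eq_bigr => u _; rewrite same_order_shift.
Qed.

Lemma nu_lsum l ss p q : components l ss -> perm0 p -> perm0 q ->
  nu (foldr (lsum l) [::] ss) (lsum l p q) =
  \sum_(j < (size ss).+1) nu (foldr (lsum l) [::] (take j ss)) p *
                          nu (foldr (lsum l) [::] (drop j ss)) q.
Proof.
move=> C pp pq; have [p' [q' [-> pq' [c Ec] [d Ed]]]] := precedes_lsum l pp pq.
rewrite nu_subseqs big_subseqs_cat.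
under [RHS]eq_bigr => j _.
  rewrite -(nu_shift _ c p) -(nu_shift _ d q) -Ec -Ed !nu_subseqs big_distrlr /=.
  over.
rewrite [RHS]exchange_big /= big_seq [RHS]big_seq; apply: eq_bigr => a Ha.
rewrite [RHS]exchange_big /= big_seq [RHS]big_seq; apply: eq_bigr => b Hb.
apply: same_order_components => //.
apply/allrelP => x y xa yb; apply: (allrelP pq').
  exact: subseqs_subset xa.
exact: subseqs_subset yb.
Qed.

Lemma nu_nil s : nu s [::] = (s == [::]).
Proof.
rewrite nu_subseqs big_seq1; congr nat_of_bool.
by apply/same_orderP/eqP => [[/esym/size0nil]|->].
Qed.

Lemma nu_gt_size s p : size p < size s -> nu s p = 0.
Proof.
move=> lt; rewrite nu_subseqs big_seq big1 // => u Hu.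
suff Hs : size u <= size p by rewrite /same_order ltn_eqF //; apply: leq_ltn_trans lt.
elim: p u Hu {lt} => [|x p IH] u /=; first by rewrite inE => /eqP ->.
by rewrite mem_cat => /orP[/mapP[v /IH + ->]|/IH] //=; lia.
Qed.

(** * Splitting off the first component *)

Lemma separable_lsum l s t : separable s -> separable t -> separable (lsum l s t).
Proof. by case: l => /= ss st; [apply: separable_dsum|apply: separable_ssum]. Qed.

Lemma fold_separable l ss : 0 < size ss ->
  (forall s, s \in ss -> separable s) -> separable (foldr (lsum l) [::] ss).
Proof.
elim: ss => [|s [|t ss] IH] // _ H.
  by rewrite /= lsums0; apply: H; rewrite mem_head.
apply: separable_lsum; first by apply: H; rewrite mem_head.
by apply: IH => // u Hu; apply: H; rewrite inE Hu orbT.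
Qed.

Lemma Gamma_separable s T : Gamma s T -> separable s.
Proof.
elim=> [|l ss Ts n1 _ _ _ IH]; first exact: separable_one.
apply: fold_separable; first exact: ltnW.
by move=> u /(nthP [::])[i Hi <-]; apply: IH.
Qed.

Lemma mem_Sep n s : (s \in Sep n) = (size s == n) && `[< separable s >].
Proof.
rewrite mem_filter andbC mem_permutations; have [|] := boolP `[< _ >]; last first.
  by rewrite !andbF.
move/asboolP/separable_is_perm; rewrite is_permE !andbT => /andP[_ ps].
apply/idP/eqP => [/perm_size|<- //]; by rewrite size_iota.
Qed.

(** The empty word stands for what remains when an indecomposable permutation loses its first
    component. *)
Definition Sep0 (n : nat) : seq (seq nat) := if n is 0 then [:: [::]] else Sep n.

Definition Indec (l : label) (n : nat) : seq (seq nat) :=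
  [seq s <- Sep n | `[< ~ decomposable l s >]].

Lemma mem_Sep0 n s :
  (s \in Sep0 n) = (size s == n) && ((s == [::]) || `[< separable s >]).
Proof.
case: n => [|n]; first by rewrite inE size_eq0; case: eqP.
by rewrite mem_Sep; case: s.
Qed.

Lemma mem_Indec l n s : (s \in Indec l n) =
  [&& size s == n, `[< separable s >] & `[< ~ decomposable l s >]].
Proof. by rewrite mem_filter mem_Sep andbC andbA. Qed.

Lemma Sep_perm0 n s : s \in Sep n -> perm0 s.
Proof.
by rewrite mem_Sep => /andP[_ /asboolP /separable_is_perm]; rewrite is_permE => /andP[].
Qed.

Lemma Indec_perm0 l n s : s \in Indec l n -> perm0 s.
Proof. by rewrite mem_filter => /andP[_ /Sep_perm0]. Qed.

Lemma Sep0_perm0 n s : s \in Sep0 n -> perm0 s.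
Proof. by case: n => [|n]; [rewrite inE => /eqP ->|apply: Sep_perm0]. Qed.

Lemma Sep_uniq n : uniq (Sep n).
Proof. exact/filter_uniq/permutations_uniq. Qed.

Lemma Sep0_uniq n : uniq (Sep0 n).
Proof. by case: n => // n; apply: Sep_uniq. Qed.

Lemma Sep_0 : Sep 0 = [::].
Proof.
case E : (Sep 0) => [//|s r].
have : s \in Sep 0 by rewrite E mem_head.
rewrite mem_Sep => /andP[/eqP s0 /asboolP /separable_is_perm].
by rewrite is_permE s0.
Qed.

Lemma separable_head_component l s : separable s ->
  exists t u, [/\ separable t, ~ decomposable l t, u = [::] \/ separable u &
    s = lsum l t u].
Proof.
move=> /Gamma_total[T] /(Gamma_components l)[ss [Ts [n0 En -> D G]]].
have sep i : i < size ss -> separable (nth [::] ss i).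
  by move=> /G /Gamma_separable.
case: ss n0 {En G} D sep => // t ss _ D sep.
exists t, (foldr (lsum l) [::] ss); split=> //; [exact: (sep 0)|exact: (D 0)|].
case: ss sep {D} => [|u ss] sep; [by left|right].
apply: fold_separable => // v /(nthP [::])[i Hi <-]; exact: (sep i.+1).
Qed.

Lemma lsum_Indec_inj l a b n s t u v :
  s \in Indec l a -> u \in Sep0 (n - a) -> t \in Indec l b -> v \in Sep0 (n - b) ->
  lsum l s u = lsum l t v -> s = t /\ u = v.
Proof.
rewrite !mem_Indec => /and3P[_ /asboolP /separable_is_perm ps /asboolP ds].
move=> /Sep0_perm0 pu /and3P[_ /asboolP /separable_is_perm pt /asboolP dt].
move=> /Sep0_perm0 pv E; have [lt|lt|eq] := ltngtP (size s) (size t).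
- by case: dt; apply: lsum_cancel pt ps pv pu (esym E) lt.
- by case: ds; apply: lsum_cancel ps pt pu pv E lt.
exact: lsum_inj eq E.
Qed.

(** Existence of the first component comes from the decomposition tree, uniqueness from
    [lsum_Indec_inj]. *)
Lemma big_Sep (l : label) (n : nat) (F : seq nat -> nat) :
  \sum_(p <- Sep n) F p =
  \sum_(a < n.+1) \sum_(s <- Indec l a) \sum_(t <- Sep0 (n - a)) F (lsum l s t).
Proof.
pose M a := [seq lsum l s t | s <- Indec l a, t <- Sep0 (n - a)].
transitivity (\sum_(p <- flatten [seq M a | a <- iota 0 n.+1]) F p); last first.
  rewrite big_flatten big_map -[iota 0 n.+1]/(index_iota 0 n.+1) big_mkord.
  by apply: eq_bigr => a _; rewrite big_allpairs_dep.
have uM a : uniq (M a).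
  apply: allpairs_uniq; [exact/filter_uniq/Sep_uniq|exact: Sep0_uniq|].
  move=> [s u] [t v] /allpairsP[[s' u'] /= [Hs Hu [-> ->]]].
  move=> /allpairsP[[t' v'] /= [Ht Hv [-> ->]]] /= E.
  by have [-> ->] := lsum_Indec_inj Hs Hu Ht Hv E.
apply/perm_big/uniq_perm; first exact: Sep_uniq.
(* The blocks [M a] are disjoint because [a] is the length of the first component, which the sum
   determines. *)
- rewrite -(map_id (flatten _)) map_flatten -map_comp.
  apply: (@allpairs_uniq_dep _ _ _ (fun _ p => p) _ M); rewrite ?iota_uniq //.
  move=> [a p] [b q] /allpairsPdep[a' [p' [_ Hp [-> ->]]]].
  move=> /allpairsPdep[b' [q' [_ Hq [-> ->]]]] /= E.
  case/allpairsP: (Hp) => -[s u] /= [Hs Hu Ep].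
  case/allpairsP: (Hq) => -[t v] /= [Ht Hv Eq].
  have [Est _] := lsum_Indec_inj Hs Hu Ht Hv (etrans (esym Ep) (etrans E Eq)).
  have Eab : a' = b'.
    move: Hs Ht; rewrite !mem_Indec Est => /and3P[/eqP <- _ _].
    by case/and3P => /eqP <-.
  by rewrite E Eab.
move=> p; apply/idP/flatten_mapP => [|[a Ha /allpairsP[[s t] /= [Hs Ht ->]]]].
  rewrite mem_Sep => /andP[/eqP Ep /asboolP].
  move=> /(separable_head_component l)[t [u [st dt su E]]].
  exists (size t); first by rewrite mem_iota -Ep E size_lsum; lia.
  apply/allpairsP; exists (t, u); split=> //=.
    by rewrite mem_Indec eqxx /=; apply/andP; split; apply/asboolP.
  rewrite mem_Sep0 -Ep E size_lsum addKn eqxx /=.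
  by case: su => [->//|su]; apply/orP; right; apply/asboolP.
move: Ha Hs Ht; rewrite mem_iota mem_Indec mem_Sep0 mem_Sep size_lsum.
move=> /= Ha /and3P[/eqP -> /asboolP ss _] /andP[/eqP -> Ht].
apply/andP; split; first by apply/eqP; lia.
apply/asboolP; case/orP: Ht => [/eqP ->|/asboolP st]; first by rewrite lsums0.
exact: separable_lsum.
Qed.

Lemma big_Sep_components (l : label) (ss : seq (seq nat)) (n : nat) :
  components l ss ->
  popularity (foldr (lsum l) [::] ss) (Sep n) =
  \sum_(j < (size ss).+1) \sum_(a < n.+1)
    popularity (foldr (lsum l) [::] (take j ss)) (Indec l a) *
    popularity (foldr (lsum l) [::] (drop j ss)) (Sep0 (n - a)).
Proof.
move=> C; rewrite /popularity (big_Sep l) exchange_big /=; apply: eq_bigr => a _.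
under [RHS]eq_bigr => j _ do rewrite big_distrlr /=.
rewrite [RHS]exchange_big /= big_seq [RHS]big_seq; apply: eq_bigr => s Hs.
rewrite [RHS]exchange_big /= big_seq [RHS]big_seq; apply: eq_bigr => t Ht.
by apply: nu_lsum => //; [apply: Indec_perm0 Hs|apply: Sep0_perm0 Ht].
Qed.

(** A separable permutation other than 1 is indecomposable for exactly one of the sums, and 1 is too
    short to contain [s]. *)
Lemma popularity_Indec_split s n : 1 < size s ->
  popularity s (Sep n) = popularity s (Indec Plus n) + popularity s (Indec Minus n).
Proof.
move=> s1; rewrite /popularity !big_filter [in RHS]big_mkcond /=.
rewrite [X in _ + X]big_mkcond -big_split /=.
have -> : \sum_(p <- permutations (iota 1 n) | `[< separable p >]) nu s p =
  \sum_(p <- Sep n) nu s p.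
  by rewrite big_filter.
rewrite big_seq [RHS]big_seq; apply: eq_bigr => p.
rewrite mem_Sep => /andP[_ /asboolP sp].
have D : p = [:: 1] \/ exists l, decomposable l p.
  case: sp => [|t u st su|t u st su]; [by left|right; exists Plus|right; exists Minus];
    by exists t, u; split=> //; apply: separable_is_perm.
case: D => [->|[l D]]; first by rewrite nu_gt_size //; do 2 case: ifP.
have D' := decomposable_opp D.
by case: l D D' => /= D D'; rewrite (asboolT D') asboolF // ?addn0.
Qed.

(** * The permutation omega(lambda) *)

Lemma compl_lsum l s t : perm0 s -> perm0 t ->
  compl (lsum l s t) = lsum (opp_label l) (compl s) (compl t).
Proof.
move=> ps pt; have bs := perm_eq_iota_mem ps; have bt := perm_eq_iota_mem pt.
rewrite /compl size_lsum; case: l; rewrite /= /dsum /ssum map_cat -!map_comp size_map.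
  congr (_ ++ _); first by apply/eq_in_map => x /bs /=; lia.
  by apply: eq_map => x /=; lia.
congr (_ ++ _); first by apply: eq_map => x /=; lia.
by apply/eq_in_map => x /bt /=; lia.
Qed.

Lemma compl_fold l ss : (forall s, s \in ss -> is_perm s) ->
  compl (foldr (lsum l) [::] ss) =
  foldr (lsum (opp_label l)) [::] [seq compl s | s <- ss].
Proof.
elim: ss => //= s ss IH H.
have Hss t : t \in ss -> is_perm t by move=> Ht; apply: H; rewrite inE Ht orbT.
rewrite compl_lsum ?IH //.
  by have := H s (mem_head _ _); rewrite is_permE => /andP[].
by apply: fold_perm_eq => i Hi; apply: Hss; apply: mem_nth.
Qed.

(* The recursion of omega with the complement traded for the opposite sum.  *)
Fixpoint alternating (l : label) (lam : seq nat) : seq nat :=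
  if lam is a :: mu then
    foldr (lsum l) [::] (rcons (nseq a [:: 1]) (alternating (opp_label l) mu))
  else [:: 1].

Fixpoint chain (l : label) (lam : seq nat) : tree :=
  if lam is a :: mu then Node l (rcons (nseq a Leaf) (chain (opp_label l) mu))
  else Leaf.

Lemma mem_rcons_nseq (T : eqType) (x y z : T) a :
  z \in rcons (nseq a x) y -> z = x \/ z = y.
Proof.
rewrite mem_rcons inE mem_nseq => /orP[/eqP->|/andP[_ /eqP->]]; first by right.
by left.
Qed.

Lemma alternating_is_perm l lam : is_perm (alternating l lam).
Proof.
elim: lam l => //= a mu IH l; apply: fold_is_perm; first by rewrite size_rcons.
by move=> i /(mem_nth [::]) /mem_rcons_nseq[] ->.
Qed.

Lemma compl_alternating l lam :
  compl (alternating l lam) = alternating (opp_label l) lam.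
Proof.
elim: lam l => //= a mu IH l; rewrite compl_fold; last first.
  by move=> s /mem_rcons_nseq[] -> //; apply: alternating_is_perm.
by rewrite map_rcons IH map_nseq.
Qed.

Lemma idperm_fold n : idperm n = foldr dsum [::] (nseq n [:: 1]).
Proof.
by elim: n => //= n <-; rewrite /idperm /dsum /= map_addn_iota.
Qed.

(** Complementing swaps the two sums. The extra entry of the base case [idperm a.+1] is the value 1
    of [alternating] at the empty partition. *)
Lemma omega_alternating lam : omega lam = alternating Plus lam.
Proof.
elim: lam => // a [|b mu] IH.
  rewrite [LHS]/= idperm_fold [RHS]/=; congr (foldr _ _ _).
  by elim: (a) => //= n <-.
rewrite -[LHS]/(dsum (idperm a) (compl (omega (b :: mu)))) IH compl_alternating.
rewrite idperm_fold -[RHS]/(foldr (lsum Plus) [::] (rcons _ _)) -cats1.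
by rewrite lsum_fold_cat -[foldr _ _ [:: _]]/(lsum Plus _ _) lsums0.
Qed.

Lemma reduced_degrees_chain l lam : reduced_degrees (chain l lam) = lam.
Proof.
elim: lam l => //= a mu IH l; rewrite size_rcons size_nseq; congr cons.
rewrite map_rcons flatten_rcons IH.
by have -> : flatten [seq reduced_degrees U | U <- nseq a Leaf] = [::]; elim: (a).
Qed.

(** Positive parts give every node at least two children, and the alternating labels make the last
    child indecomposable for its parent's sum. *)
Lemma Gamma_alternating l lam : all (leq 1) lam ->
  Gamma (alternating l lam) (chain l lam).
Proof.
elim: lam l => [|a mu IH] l; first by move=> _; apply: Gamma_one.
move=> /= /andP[a0 /IH{}IH].
have G i : i < a.+1 ->
    Gamma (nth [::] (rcons (nseq a [:: 1]) (alternating (opp_label l) mu)) i)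
          (nth Leaf (rcons (nseq a Leaf) (chain (opp_label l) mu)) i) /\
    ~~ rooted l (nth Leaf (rcons (nseq a Leaf) (chain (opp_label l) mu)) i).
  rewrite !nth_rcons !size_nseq !nth_nseq ltnS leq_eqVlt => /orP[/eqP ->|lt].
    by rewrite ltnn eqxx; split=> //; case: (mu) l {IH} => [|? ?] [].
  by rewrite lt; split; [apply: Gamma_one|case: l {IH}].
apply: Gamma_node; rewrite ?size_rcons ?size_nseq // => i /G[] //.
exact: Gamma_indecomposable.
Qed.

Lemma Gamma_reduced_degrees_gt0 s T : Gamma s T -> all (leq 1) (reduced_degrees T).
Proof.
elim=> //= l ss Ts n1 En _ _ IH; apply/andP; split; first by rewrite -En; lia.
have -> (r : seq (seq nat)) : all (leq 1) (flatten r) = all (all (leq 1)) r.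
  by elim: r => //= u r <-; rewrite all_cat.
rewrite all_map; apply/(all_nthP Leaf) => i Hi /=.
by apply: IH; rewrite En.
Qed.

(** * Generating functions *)

Local Open Scope ring_scope.

(** Both factors are values of polynomials. In their product the coefficients below degree N are
    full convolutions, and the others are killed by [x ^+ N = 0]. *)
Lemma cauchy_truncated (K : comNzRingType) (x : K) (N : nat) (u v : nat -> K) :
  x ^+ N = 0 ->
  \sum_(n < N) (\sum_(a < n.+1) u a * v (n - a)%N) * x ^+ n =
  (\sum_(a < N) u a * x ^+ a) * (\sum_(b < N) v b * x ^+ b).
Proof.
move=> xN; rewrite -!horner_poly -hornerM.
set p := \poly_(i < N) u i; set q := \poly_(i < N) v i.
have sz : (size (p * q)%R <= N + N)%N.
  apply: leq_trans (size_polyMleq _ _) _.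
  by have := size_poly N u; have := size_poly N v; rewrite -/p -/q; lia.
rewrite (horner_coef_wide x sz) big_split_ord /= [X in _ + X]big1 ?addr0; last first.
  by move=> i _; rewrite exprD xN mul0r mulr0.
apply: eq_bigr => n _; rewrite coefM; congr (_ * _).
apply: eq_bigr => a _; have Hn := ltn_ord n; have Ha := ltn_ord a.
by rewrite !coef_poly !ifT //; lia.
Qed.

Section GeneratingFunctions.

Variables (K : comNzRingType) (x : K) (N : nat).
Hypothesis xN : x ^+ N = 0.

Definition gf (X : nat -> seq (seq nat)) (s : seq nat) : K :=
  \sum_(n < N) (popularity s (X n))%:R * x ^+ n.

Notation G := (gf Sep).
Notation H l := (gf (Indec l)).
(** The empty pattern occurs exactly once in every word, so [A] and [B] simply count
    permutations. *)
Notation A l := (gf (Indec l) [::]).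
Notation B := (gf Sep0 [::]).

Lemma gf_Sep0_neq s : s != [::] -> gf Sep0 s = G s.
Proof.
move=> s0; apply: eq_bigr => -[[|n] Hn] _ //=.
by rewrite /popularity Sep_0 big_seq1 big_nil nu_nil (negbTE s0).
Qed.

Lemma N_gt0 : (0 < N)%N.
Proof. by case: (N) xN => // /eqP; rewrite expr0 oner_eq0. Qed.

Lemma gf_Sep0_nil : B = 1 + G [::].
Proof.
rewrite /gf; case: (N) N_gt0 => // n _; rewrite !big_ord_recl /=.
by rewrite /popularity Sep_0 big_seq1 big_nil nu_nil expr0 mulr1 mul0r add0r.
Qed.

Lemma gf_Sep_components l ss : components l ss ->
  G (foldr (lsum l) [::] ss) =
  \sum_(j < (size ss).+1) H l (foldr (lsum l) [::] (take j ss)) *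
                          gf Sep0 (foldr (lsum l) [::] (drop j ss)).
Proof.
move=> C; rewrite /gf.
transitivity (\sum_(j < (size ss).+1) \sum_(n < N) (\sum_(a < n.+1)
   (popularity (foldr (lsum l) [::] (take j ss)) (Indec l a))%:R *
   (popularity (foldr (lsum l) [::] (drop j ss)) (Sep0 (n - a)))%:R) * x ^+ n);
  last by apply: eq_bigr => j _; exact: (cauchy_truncated
    (fun a => (popularity _ (Indec l a))%:R) (fun b => (popularity _ (Sep0 b))%:R) xN).
rewrite exchange_big /=; apply: eq_bigr => n _.
rewrite -mulr_suml (big_Sep_components _ C) natr_sum; congr (_ * _).
apply: eq_bigr => j _; rewrite natr_sum; apply: eq_bigr => a _.
by rewrite natrM.
Qed.

Lemma A_B l : (1 - A l) * B = 1.
Proof.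
have C : components l [::] by [].
have := gf_Sep_components C.
rewrite /= big_ord_recl big_ord0 addr0 /= gf_Sep0_nil => E.
by rewrite mulrBl mul1r -E addrK.
Qed.

(** Both [1 - A l] are inverse to [B], which does not depend on the label; this stands in for the
    symmetry between the two sums. *)
Lemma A_label l : A l = A Plus.
Proof.
have E : 1 - A l = 1 - A Plus.
  transitivity ((1 - A l) * ((1 - A Plus) * B)); first by rewrite A_B mulr1.
  by rewrite mulrCA A_B mulr1.
by rewrite -[LHS](subKr 1) E subKr.
Qed.

Notation D := (1 - A Plus).

Lemma D_B : D * B = 1.
Proof. exact: A_B. Qed.

(** There is no permutation of length 0 in the class, so [x] divides [A]. *)
Lemma A_nilpotent : (A Plus) ^+ N = 0.
Proof.
suff [y ->] : exists y, A Plus = x * y by rewrite exprMn xN mul0r.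
rewrite /gf; case: (N) N_gt0 => // n _; rewrite big_ord_recl.
rewrite {1}/popularity /Indec Sep_0 big_nil mul0r add0r.
exists (\sum_(i < n) (popularity [::] (Indec Plus i.+1))%:R * x ^+ i).
by rewrite mulr_sumr; apply: eq_bigr => i _; rewrite exprS mulrCA.
Qed.

(** With D = 1 - A one has 2 D^2 - 1 = 1 - u for the nilpotent u = 2 A (2 - A), so a finite
    geometric sum inverts it. *)
Lemma D_unit : exists V, V * (2 * D ^+ 2 - 1) = 1.
Proof.
pose u := 2 * A Plus * (2 - A Plus).
have uN : u ^+ N = 0 by rewrite /u !exprMn A_nilpotent mulr0 mul0r.
exists (\sum_(i < N) u ^+ i).
have -> : 2 * D ^+ 2 - 1 = - (u - 1) by rewrite /u; ring.
by rewrite mulrN mulrC -subrX1 uN; ring.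
Qed.

Lemma H_indecomposable l s : is_perm s -> ~ decomposable l s ->
  H l s = D ^+ 2 * G s.
Proof.
move=> ps ds; have C : components l [:: s].
  by move=> t; rewrite inE => /eqP ->.
have := gf_Sep_components C; rewrite !big_ord_recl big_ord0 /= lsums0 addr0.
rewrite gf_Sep0_neq; last by case/andP: ps.
rewrite A_label => E.
have E' : D * G s = H l s * B by rewrite mulrBl mul1r {1}E; ring.
by rewrite expr2 -mulrA E' mulrCA D_B mulr1.
Qed.

(** [s] is indecomposable for the opposite sum, whose share of [G s] is therefore D^2; the rest
    belongs to [l]. *)
Lemma H_decomposable l s : is_perm s -> decomposable l s ->
  H l s = (1 - D ^+ 2) * G s.
Proof.
move=> ps ds; have s1 : (1 < size s)%N.
  case: ds => t [u [pt pu ->]]; rewrite size_lsum.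
  by move: pt pu; rewrite !is_permE => /andP[t0 _] /andP[u0 _]; lia.
have E : G s = H l s + H (opp_label l) s.
  transitivity (H Plus s + H Minus s); last by case: l {ds}; rewrite //= addrC.
  rewrite /gf -big_split; apply: eq_bigr => n _.
  by rewrite popularity_Indec_split // natrD mulrDl.
have E2 := H_indecomposable ps (decomposable_opp ds).
by rewrite mulrBl mul1r -E2 {1}E addrK.
Qed.

(** The ratio h_j between the series over indecomposables and over the whole class, for a sum of [j]
    components. *)
Definition run_weight (j : nat) : K := if j == 1%N then D ^+ 2 else 1 - D ^+ 2.

Lemma H_components l ss : components l ss -> (0 < size ss)%N ->
  H l (foldr (lsum l) [::] ss) = run_weight (size ss) * G (foldr (lsum l) [::] ss).
Proof.
move=> C; case: ss C => [|s [|t ss]] // C _; rewrite /run_weight [size _ == _]/=.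
  have [ps ds] := C s (mem_head _ _).
  by rewrite /= lsums0 H_indecomposable.
have ps i : (i < size [:: s, t & ss])%N -> is_perm (nth [::] [:: s, t & ss] i).
  by case/(components_nth C).
by apply: H_decomposable; [apply: fold_is_perm|apply: fold_decomposable].
Qed.

Lemma fold_neq_nil l ss : components l ss -> (0 < size ss)%N ->
  foldr (lsum l) [::] ss != [::].
Proof.
by move=> /fold_size_ge le n0; rewrite -size_eq0 -lt0n; apply: leq_trans le.
Qed.

Lemma gf_fold_rec l ss k : components l ss -> size ss = k.+2 ->
  (2 * D ^+ 2 - 1) * G (foldr (lsum l) [::] ss) =
  D * \sum_(i < k.+1) run_weight i.+1 * G (foldr (lsum l) [::] (take i.+1 ss)) *
                      G (foldr (lsum l) [::] (drop i.+1 ss)).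
Proof.
move=> C Es; have := gf_Sep_components C.
rewrite Es big_ord_recl big_ord_recr /= take0 drop0.
have bump0 h : bump 0%N h = h.+1 by rewrite /bump add1n.
rewrite (bump0 k.+1) -Es drop_size take_size /=.
rewrite gf_Sep0_neq ?fold_neq_nil ?Es // A_label H_components ?Es //.
set g := G (foldr _ _ ss).
rewrite (eq_bigr (fun i : 'I_k.+1 => run_weight i.+1 *
  G (foldr (lsum l) [::] (take i.+1 ss)) *
  G (foldr (lsum l) [::] (drop i.+1 ss)))); last first.
  move=> i _; rewrite /bump /= add1n; have Hi := ltn_ord i.
  have Et : size (take i.+1 ss) = i.+1 by rewrite size_takel // Es; lia.
  rewrite H_components ?Et //; last exact: components_take.
  rewrite gf_Sep0_neq // fold_neq_nil //; first exact: components_drop.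
  by rewrite size_drop Es; lia.
set M := \sum_(i < k.+1) _; rewrite /run_weight /= => E.
(* Multiplying by D clears [B] from the last term, and D - D A - (1 - D^2) = 2 D^2 - 1. *)
have -> : D * M = D * g - D * A Plus * g - (1 - D ^+ 2) * g * (D * B).
  by rewrite {1}E; ring.
by rewrite D_B; ring.
Qed.

(** The order of quantifiers is the point: [c] is fixed before the label and the components. Both
    sides of a proper cut have fewer components, so by strong induction every term of [gf_fold_rec]
    is a constant times the same product, and [D_unit] allows the division. *)
Lemma gf_fold : exists c : nat -> K, forall l ss,
  components l ss -> (0 < size ss)%N ->
  G (foldr (lsum l) [::] ss) = c (size ss) * \prod_(s <- ss) G s.
Proof.
suff /choice[c Hc] : forall k, exists y : K, forall l ss, components l ss ->
    size ss = k -> (0 < k)%N -> G (foldr (lsum l) [::] ss) = y * \prod_(s <- ss) G s.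
  by exists c => l ss C; apply: Hc.
elim/ltn_ind => -[|[|k]] IH.
(* An arbitrary value, since [0 < k] fails here. *)
- by exists 0.
- exists 1 => l [|s [|]] // _ _ _.
  by rewrite big_seq1 mul1r /= lsums0.
have [|c Hc] := @choice nat K (fun j y => (j < k.+2)%N -> forall l ss,
    components l ss -> size ss = j -> (0 < j)%N ->
    G (foldr (lsum l) [::] ss) = y * \prod_(s <- ss) G s).
  move=> j; have [/IH [y Hy]|] := boolP (j < k.+2)%N; first by exists y => _.
  by exists 0.
have [V EV] := D_unit.
exists (V * (D * \sum_(i < k.+1) run_weight i.+1 * c i.+1 * c (k.+1 - i)%N)).
move=> l ss C Es _.
transitivity (V * (2 * D ^+ 2 - 1) * G (foldr (lsum l) [::] ss)).
  by rewrite EV mul1r.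
rewrite -mulrA (gf_fold_rec C Es).
rewrite -!mulrA; congr (_ * (_ * _)); rewrite mulr_suml; apply: eq_bigr => i _.
have Hi := ltn_ord i.
have Et : size (take i.+1 ss) = i.+1 by rewrite size_takel // Es; lia.
have Ed : size (drop i.+1 ss) = (k.+1 - i)%N by rewrite size_drop Es; lia.
rewrite (Hc _ _ l _ (@components_take l ss i.+1 C) Et) //.
have [ltk gt0] : (k.+1 - i < k.+2)%N /\ (0 < k.+1 - i)%N by lia.
rewrite (Hc _ ltk l _ (@components_drop l ss i.+1 C) Ed gt0).
rewrite -{3}(cat_take_drop i.+1 ss) big_cat /=; ring.
Qed.

(** Each of the d + 1 children of a node brings a factor [G [:: 1]]; one becomes the factor in front
    and the other d are charged to the node. *)
Lemma gf_Gamma (c : nat -> K) : (forall l ss,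
    components l ss -> (0 < size ss)%N ->
    G (foldr (lsum l) [::] ss) = c (size ss) * \prod_(s <- ss) G s) ->
  forall s T, Gamma s T ->
  G s = G [:: 1%N] * \prod_(d <- reduced_degrees T) (c d.+1 * G [:: 1%N] ^+ d).
Proof.
move=> Hc s T; elim=> [|l ss Ts n1 En ND HG IH]; first by rewrite big_nil mulr1.
rewrite Hc; last first.
- exact: ltnW.
- move=> t /(nthP [::])[i Hi <-]; split; last exact: ND.
  exact: Gamma_is_perm (HG _ Hi).
rewrite /= big_cons -En big_flatten big_map /=.
have -> : \prod_(s <- ss) G s = \prod_(T <- Ts) (G [:: 1%N] *
    \prod_(d <- reduced_degrees T) (c d.+1 * G [:: 1%N] ^+ d)).
  rewrite (big_nth [::]) (big_nth Leaf) -En !big_mkord.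
  by apply: eq_bigr => i _; apply: IH.
rewrite big_split /= big_const_seq count_predT iter_mulr_1 -En.
case: (size ss) n1 => // k _; rewrite exprS /=; ring.
Qed.

End GeneratingFunctions.

(** * Recovering popularities from the truncated series *)

(** In the integer polynomials modulo X^(m+1), the class of X is nilpotent, yet the coefficient of
    degree m can still be read off. *)
Lemma popularity_gf_inj (m : nat) (s t : seq nat) (X : nat -> seq (seq nat)) :
  let x : {poly %/ ('X^(m.+1) : {poly int})} := 'qX in
  gf x m.+1 X s = gf x m.+1 X t -> popularity s (X m) = popularity t (X m).
Proof.
move=> x E.
have coef_gf u : (gf x m.+1 X u : {poly int})`_m = (popularity u (X m))%:R.
  have -> : gf x m.+1 X u =
      in_qpoly 'X^(m.+1) (\poly_(i < m.+1) (popularity u (X i))%:R).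
    rewrite poly_def rmorph_sum; apply: eq_bigr => i _.
    by rewrite scaler_nat rmorphMn rmorphXn /= mulr_natl.
  rewrite in_qpoly_small ?coef_poly ?ltnSn //.
  by rewrite mk_monic_Xn size_polyXn ltnS size_poly.
have := congr1 (fun p : {poly %/ 'X^(m.+1)} => (p : {poly int})`_m) E.
by rewrite !coef_gf !natz => -[].
Qed.

Lemma qX_nilpotent m : ('qX : {poly %/ ('X^(m.+1) : {poly int})}) ^+ m.+1 = 0.
Proof.
rewrite -rmorphXn; apply: val_inj; rewrite /= mk_monic_Xn.
by rewrite Pdiv.RingMonic.rmodpp ?monicXn.
Qed.

Local Close Scope ring_scope.

Theorem theorem3p6 (sigma : seq nat) (T : tree) (lambda : seq nat)
    (Hsigma : separable sigma) (HT : Gamma sigma T)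
    (Hlambda : signature T = lambda) :
  forall m : nat, 1 <= m ->
    popularity sigma (Sep m) = popularity (omega lambda) (Sep m).
Proof.
move=> m _; apply: popularity_gf_inj => /=.
(* The same constants serve both trees, so the two products differ only in the order of their
   factors. *)
have [c Hc] := gf_fold (qX_nilpotent m).
have plam : perm_eq (reduced_degrees T) lambda by rewrite -Hlambda perm_sym perm_sort.
have Glam : Gamma (omega lambda) (chain Plus lambda).
  rewrite omega_alternating; apply: Gamma_alternating.
  by rewrite -(perm_all _ plam); apply: Gamma_reduced_degrees_gt0 HT.
rewrite (gf_Gamma Hc HT) (gf_Gamma Hc Glam) reduced_degrees_chain.
by congr (_ * _)%R; apply: perm_big.
Qed.
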